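(* Let $\Phi=\{\varphi_n\}_{n=1}^N\subseteq\mathbb{C}^M$ and let $\mathcal{A}\colon\mathbb{C}^M/\mathbb{T}\rightarrow\mathbb{R}^N$ be defined by $(\mathcal{A}(x))(n):=|\langle x,\varphi_n\rangle|^2$. For $u\in\mathbb{C}^M$, viewing $\{\varphi_n\varphi_n^*u\}_{n=1}^N$ as vectors in $\mathbb{R}^{2M}$, denote $S(u):=\operatorname{span}_{\mathbb{R}}\{\varphi_n\varphi_n^*u\}_{n=1}^N$. Then the following are equivalent: (a) $\mathcal{A}$ is injective. (b) $\dim_{\mathbb{R}} S(u)\geq 2M-1$ for every $u\in\mathbb{C}^M\setminus\{0\}$. (c) $S(u)=\operatorname{span}_{\mathbb{R}}\{\mathrm{i}u\}^{\perp}$ for every $u\in\mathbb{C}^M\setminus\{0\}$.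
   Context: $\mathbb{T}=\{c\in\mathbb{C}:|c|=1\}$. $\mathbb{C}^M/\mathbb{T}$ denotes $\mathbb{C}^M$ with $x$ and $y$ identified whenever $y=cx$ for some $c\in\mathbb{T}$; injectivity of $\mathcal{A}$ means: $\mathcal{A}(x)=\mathcal{A}(y)$ implies $y=cx$ for some $c\in\mathbb{T}$. The inner product on $\mathbb{C}^M$ is $\langle x,\varphi\rangle=\varphi^*x=\sum_m x(m)\overline{\varphi(m)}$. $\mathbb{C}^M$ is identified with $\mathbb{R}^{2M}$ via real and imaginary parts, and $\perp$ is the orthogonal complement in $\mathbb{R}^{2M}$ with respect to the real inner product $\langle a,b\rangle_{\mathbb{R}}=\operatorname{Re}\langle a,b\rangle$. *)

(* Defs.v *)
From HB Require Import structures.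
From mathcomp Require Import all_boot all_order all_algebra.
From mathcomp Require Import reals.
From mathcomp Require Import complex.

Set Implicit Arguments.
Unset Strict Implicit.
Unset Printing Implicit Defensive.

Import Order.TTheory GRing.Theory Num.Theory.
Local Open Scope ring_scope.
Local Open Scope sesquilinear_scope.

Section PhaseRetrieval.
Variable R : realType.
Local Notation C := R[i].

(* Linear in the first argument, conjugate-linear in the second. *)
Definition cdot (M : nat) (x phi : 'cV[C]_M) : C := (phi ^t* *m x) 0 0.

(* The modulus is [Normc.normc], valued in R, since the norm [`|z|] of the
   library is an element of C. *)
Definition intensity (M N : nat) (phi : 'I_N -> 'cV[C]_M) (x : 'cV[C]_M) :
    'rV[R]_N :=
  \row_n Normc.normc (cdot x (phi n)) ^+ 2.

Definition phase_equiv (M : nat) (x y : 'cV[C]_M) : Prop :=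
  exists2 c : C, Normc.normc c = 1 & y = c *: x.

(* Injectivity of the map that f induces on the quotient of C^M by the unit
   circle. *)
Definition injective_mod_phase (M : nat) (T : Type) (f : 'cV[C]_M -> T) : Prop :=
  forall x y : 'cV[C]_M, f x = f y -> phase_equiv x y.

(* The identification of C^M with R^(2M): real parts stacked on imaginary
   parts. *)
Definition realify (M : nat) (x : 'cV[C]_M) : 'cV[R]_(M + M) :=
  col_mx (map_mx (@complex.Re R) x) (map_mx (@complex.Im R) x).

Definition complexify (M : nat) (a : 'cV[R]_(M + M)) : 'cV[C]_M :=
  \col_i (usubmx a i 0 +i* dsubmx a i 0)%C.

Lemma realifyK (M : nat) : cancel (@realify M) (@complexify M).
Proof.
move=> x; apply/colP => i.
by rewrite mxE col_mxKu col_mxKd !mxE; case: (x i 0).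
Qed.

Lemma complexifyK (M : nat) : cancel (@complexify M) (@realify M).
Proof.
move=> a; rewrite -[RHS]vsubmxK.
by congr col_mx; apply/colP => i; rewrite !mxE.
Qed.

Definition rdot (M : nat) (a b : 'cV[R]_(M + M)) : R :=
  complex.Re (cdot (complexify a) (complexify b)).

Lemma rdotE (M : nat) (a b : 'cV[R]_(M + M)) : rdot a b = \sum_i a i 0 * b i 0.
Proof.
rewrite /rdot /cdot mxE (raddf_sum (@complex.Re R : {additive Rcomplex R -> R})).
rewrite big_split_ord /= -big_split /=; apply: eq_bigr => i _.
by rewrite !mxE /= mulNr opprK ![b _ _ * _]mulrC.
Qed.

Lemma rdot_is_bilinear (M : nat) : bilinear_for
  (GRing.Scale.Law.clone _ _ *%R _)
  (GRing.Scale.Law.clone _ _ (@idfun R \; *%R) _) (@rdot M).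
Proof.
split=> [b|a] k x y; rewrite /= !rdotE mulr_sumr -big_split;
  apply: eq_bigr => i _; rewrite !mxE /=.
  by rewrite mulrDl mulrA.
by rewrite mulrDr mulrCA.
Qed.

HB.instance Definition _ (M : nat) :=
  bilinear_isBilinear.Build R _ _ _ _ _ (@rdot M) (rdot_is_bilinear M).

Lemma rdot_is_symmetric (M : nat) (a b : 'cV[R]_(M + M)) :
  rdot a b = (-1) ^+ false * idfun (rdot b a).
Proof.
by rewrite mul1r !rdotE; apply: eq_bigr => i _; rewrite mulrC.
Qed.

HB.instance Definition _ (M : nat) :=
  isHermitianSesquilinear.Build R _ false idfun (@rdot M)
    (@rdot_is_symmetric M).

Definition frame_span (M N : nat) (phi : 'I_N -> 'cV[C]_M) (u : 'cV[C]_M) :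
    {vspace 'cV[R]_(M + M)} :=
  <<[seq realify (phi n *m (phi n) ^t* *m u) | n : 'I_N]>>%VS.

Definition real_orthogonal (M : nat) (V : {vspace 'cV[R]_(M + M)}) :
    {vspace 'cV[R]_(M + M)} :=
  orthov (@rdot M) V.

End PhaseRetrieval.

(* Main.v *)
(** For [u = x + y] and [v = x - y] the polarization identity reads
    [|<x, phi>|^2 - |<y, phi>|^2 = Re <phi phi^* u, v>], so two vectors have the
    same intensities exactly when [v] is real-orthogonal to [S(u)].  The vector
    [i u] is always orthogonal to [S(u)], and by the Cayley transform
    [t |-> (1 - t i) / (1 + t i)] the vectors [x] and [y] differ by a phase
    exactly when [u = 0] or [v] is a real multiple of [i u].  Hence injectivity says
    that the orthogonal complement of each [S(u)] is the line through [i u];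
    the rest is a dimension count. *)

Require Import Defs.
From mathcomp Require Import all_boot all_order all_algebra.
From mathcomp Require Import reals.
From mathcomp Require Import complex.
From mathcomp Require Import ring lra.

Set Implicit Arguments.
Unset Strict Implicit.
Unset Printing Implicit Defensive.

Import Order.TTheory GRing.Theory Num.Theory.
Local Open Scope ring_scope.
Local Open Scope sesquilinear_scope.

Section Orthogonal.
Variables (F : fieldType) (eps : bool) (theta : {rmorphism F -> F}).
Variables (vT : vectType F) (form : {hermitian vT for eps & theta}).

Lemma orthov_add (U V : {vspace vT}) :
  orthov form (U + V) = (orthov form U :&: orthov form V)%VS.
Proof.
apply/vspaceP => w; rewrite memv_cap !memvE.
by rewrite orthov_sym orthoDv ![(_ <= orthov _ <[w]>)%VS]orthov_sym.
Qed.

(** Induction on a basis of [V]: each further vector imposes one linear equation on the complement,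
    so lowers its dimension by at most one. *)
Lemma dimv_orthov (V : {vspace vT}) :
  (\dim {:vT} <= \dim V + \dim (orthov form V))%N.
Proof.
rewrite -{2}(span_basis (vbasisP V)) -{1}(size_tuple (vbasis V)).
elim: (tval _) => [|x X IH] /=; first by rewrite span_nil orthov0.
rewrite span_cons orthov_add capvC.
have := leq_dim_orthov1 form x (orthov form <<X>>).
rewrite -ltnS => /(leq_trans (leqSpred _)).
by rewrite -(leq_add2l (size X)) addnS; exact: leq_trans.
Qed.

End Orthogonal.

Section Phase.
Variable R : realType.
Local Notation C := R[i].

Lemma realifyZ M (t : R) (x : 'cV[C]_M) : realify (t%:C%C *: x) = t *: realify x.
Proof.
rewrite /realify scale_col_mx; congr col_mx; apply/colP => i; rewrite !mxE;
  by case: (x i 0) => a b /=; rewrite mul0r ?subr0 ?addr0.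
Qed.

Lemma realify_eq0 M (x : 'cV[C]_M) : (realify x == 0) = (x == 0).
Proof.
have r0 : realify (0 : 'cV[C]_M) = 0.
  by rewrite -[0 in LHS](scale0r 0) (realifyZ 0) scale0r.
by rewrite -[in LHS]r0 (inj_eq (can_inj (@realifyK R M))).
Qed.

Lemma rdot_eq0 M (a : 'cV[R]_(M + M)) : (rdot a a == 0) = (a == 0).
Proof.
rewrite rdotE psumr_eq0 => [|i _]; last by rewrite -expr2 sqr_ge0.
apply/allP/eqP => [a0 | -> i _]; last by rewrite mxE mulr0 eqxx.
by apply/colP => i; apply/eqP; rewrite mxE -sqrf_eq0 expr2; exact: a0 (mem_index_enum i).
Qed.

(** By positive definiteness: if [v] is in the double complement, the remainder [z] of its
    projection onto [w] is orthogonal to [w], hence to [v], hence to itself. *)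
Lemma orthovK1 M (w : 'cV[R]_(M + M)) :
  orthov (@rdot R M) (orthov (@rdot R M) <[w]>) = <[w]>%VS.
Proof.
apply/eqP; rewrite eqEsubv [X in _ && X]orthov_sym subvv andbT.
apply/subvP => v /mem_orthovP v_perp; have [w0 | w0] := eqVneq w 0.
  by have := v_perp v; rewrite w0 orthov0 memvf => /(_ isT)/eqP; rewrite rdot_eq0 memv0.
pose z := v - (rdot v w / rdot w w) *: w.
have z_w : rdot z w = 0.
  by rewrite linearBl linearZl_LR /= divfK ?subrr // rdot_eq0.
have : rdot z z = 0.
  rewrite {1}/z linearBl linearZl_LR /= v_perp; last by rewrite mem_orthov1; apply/eqP.
  have -> : rdot w z = rdot z w by rewrite !rdotE; apply: eq_bigr => i _; rewrite mulrC.
  by rewrite z_w mulr0 subrr.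
by move/eqP; rewrite rdot_eq0 subr_eq0 => /eqP ->; rewrite memvZ ?memv_line.
Qed.

Lemma rdot_realify M (x y : 'cV[C]_M) : rdot (realify x) (realify y) = complex.Re (cdot x y).
Proof. by rewrite /rdot !realifyK. Qed.

Lemma cdotC M (x y : 'cV[C]_M) : cdot x y = (cdot y x)^*.
Proof.
rewrite /cdot !mxE rmorph_sum; apply: eq_bigr => i _.
by rewrite !mxE rmorphM /= conjCK mulrC.
Qed.

Lemma cdot_frame M (phi u v : 'cV[C]_M) :
  cdot (phi *m phi ^t* *m u) v = cdot u phi * (cdot v phi)^*.
Proof. by rewrite -cdotC /cdot -(mulmxA phi) (mulmxA _ phi) [LHS]mxE big_ord1 mulrC. Qed.

Lemma cdotDl M (x y phi : 'cV[C]_M) : cdot (x + y) phi = cdot x phi + cdot y phi.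
Proof. by rewrite /cdot mulmxDr mxE. Qed.

Lemma cdotZl M c (x phi : 'cV[C]_M) : cdot (c *: x) phi = c * cdot x phi.
Proof. by rewrite /cdot -scalemxAr mxE. Qed.

Lemma sqr_normc_def (z : C) : Normc.normc z ^+ 2 = complex.Re z ^+ 2 + complex.Im z ^+ 2.
Proof. by case: z => a b /=; rewrite sqr_sqrtr // addr_ge0 ?sqr_ge0. Qed.

Lemma sqr_normc_sub (a b : C) :
  Normc.normc a ^+ 2 - Normc.normc b ^+ 2 = complex.Re ((a + b) * (a - b)^*).
Proof. rewrite !sqr_normc_def; case: a b => a1 a2 [b1 b2] /=; ring. Qed.

Lemma eq_intensity M N (phi : 'I_N -> 'cV[C]_M) x y :
  intensity phi x = intensity phi y <->
  realify (x - y) \in orthov (@rdot R M) (frame_span phi (x + y)).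
Proof.
have E n : intensity phi x 0 n - intensity phi y 0 n =
    rdot (realify (phi n *m (phi n) ^t* *m (x + y))) (realify (x - y)).
  rewrite rdot_realify cdot_frame !mxE sqr_normc_sub !cdotDl.
  by rewrite -[- y]scaleN1r cdotZl mulN1r.
(* By symmetry it suffices to test the generators of [S(x + y)] against [x - y]. *)
rewrite memvE orthov_sym; split => [eqA | /subvP S].
  apply/span_subvP => _ /imageP [n _ ->]; rewrite mem_orthov1.
  by rewrite /= -E eqA subrr.
apply/rowP => n; apply/eqP; rewrite -subr_eq0 E.
by rewrite -mem_orthov1 S // memv_span //; apply/imageP; exists n.
Qed.

(** The product [<phi phi^* u, i u>] equals [- i |<u, phi>|^2], which is purely imaginary. *)
Lemma frame_span_sub M N (phi : 'I_N -> 'cV[C]_M) u :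
  (frame_span phi u <= orthov (@rdot R M) <[realify ('i *: u)]>)%VS.
Proof.
apply/span_subvP => _ /imageP [n _ ->]; rewrite mem_orthov1.
rewrite /= rdot_realify cdot_frame cdotZl -complexiE; case: (cdot u _) => a b /=.
by apply/eqP; ring.
Qed.

Lemma normc1_cayley (c : C) : Normc.normc c = 1 -> 1 + c != 0 ->
  exists t : R, 1 - c = (1 + c) * (t%:C%C * 'i).
Proof.
move=> /(congr1 (fun r => r ^+ 2)); rewrite sqr_normc_def expr1n -complexiE.
case: c => a b /= ab1 c0.
have a0 : 1 + a != 0.
  (* On the unit circle, real part [-1] forces [c = -1]. *)
  apply: contraNneq c0 => a0.
  have b0 : b = 0 by apply/eqP; rewrite -sqrf_eq0; apply/eqP; nra.
  by rewrite eq_complex /= a0 b0 addr0 eqxx.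
(* For [|c| = 1] the quotient [(1 - c) / (1 + c)] is purely imaginary; [t] is its imaginary part. *)
pose t := - b / (1 + a); have tE : t * (1 + a) = - b by rewrite divfK.
exists t; apply/eqP; rewrite eq_complex /=; apply/andP; split; apply/eqP; last by lra.
apply: (mulfI a0); have -> : (1 + a) * (1 - a) = b ^+ 2 by lra.
by transitivity (- b * (t * (1 + a))); [rewrite tE|]; ring.
Qed.

(** The numbers [1 - z] and [1 + z] are conjugate, with real part [1]. *)
Lemma normc_cayley (t : R) (z := t%:C%C * 'i : C) :
  1 + z != 0 /\ Normc.normc ((1 - z) / (1 + z)) = 1.
Proof.
have N : Normc.normc (1 - z) = Normc.normc (1 + z).
  by rewrite /z -complexiE /=; congr Num.sqrt; ring.
have z0 : 1 + z != 0.
  rewrite /z -complexiE eq_complex /= negb_and.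
  by apply/orP; left; apply/eqP; lra.
split=> //; rewrite Normc.normcM Normc.normcV N divff //.
by apply: contra z0 => /eqP/Normc.eq0_normc ->.
Qed.

Lemma injective_perp M N (phi : 'I_N -> 'cV[C]_M) u v :
  injective_mod_phase (intensity phi) -> u != 0 ->
  realify v \in orthov (@rdot R M) (frame_span phi u) ->
  exists t : R, v = t%:C%C *: ('i *: u).
Proof.
move=> inj u0 v_perp; have n2 : 2 != 0 :> C by rewrite pnatr_eq0.
have halves (w : 'cV[C]_M) : 2^-1 *: (w + w) = w.
  by rewrite -mulr2n -(scaler_nat _ w) scalerA mulVf // scale1r.
(* These two vectors have sum [u] and difference [v]. The phase [c] relating them gives
   [(1 + c) v = (1 - c) u]. *)
have /inj [c c1] :
    intensity phi (2^-1 *: (u + v)) = intensity phi (2^-1 *: (u - v)).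
  apply/eq_intensity; rewrite -scalerDr -scalerBr addrACA subrr addr0.
  by rewrite opprB [u + v + _]addrC addrA subrK !halves.
rewrite scalerA mulrC -scalerA => /(scalerI (invr_neq0 n2)) Ec.
(* If [c = -1], then [u - v = - u - v], so [u = 0]. *)
have c0 : 1 + c != 0.
  apply: contra u0; rewrite addrC addr_eq0 => /eqP c0; move/eqP: Ec.
  rewrite c0 scaleN1r opprD (can_eq (addrK _)) -addr_eq0.
  by move=> /eqP vv0; rewrite -[u]halves vv0 scaler0.
have [t Et] := normc1_cayley c1 c0; exists t.
apply: (scalerI c0); rewrite !scalerA -mulrA -Et scalerBl scale1r scalerDl scale1r.
by apply/eqP; rewrite eq_sym subr_eq -addrA -scalerDr [v + u]addrC -Ec addrC subrK.
Qed.

End Phase.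

Theorem theorem4 (R : realType) (M N : nat) (phi : 'I_N -> 'cV[R[i]]_M) :
  [<-> injective_mod_phase (intensity phi);
       forall u : 'cV[R[i]]_M, u != 0 ->
         (2 * M - 1 <= \dim (frame_span phi u))%N;
       forall u : 'cV[R[i]]_M, u != 0 ->
         frame_span phi u = real_orthogonal <[realify ('i *: u)]>%VS].
Proof.
have dimT : \dim {: 'cV[R]_(M + M)} = (2 * M)%N
  by rewrite dimvf /dim /= muln1 addnn mul2n.
tfae.
- move=> inj u u0; have := dimv_orthov (@rdot R M) (frame_span phi u).
  rewrite dimT leq_subLR => /leq_trans -> //; rewrite addnC leq_add2r.
  (* It remains to bound the dimension of the complement of [S(u)] by one: it lies in the line
     through [i u]. *)
  have le1 : (\dim <[realify ('i *: u)]>%VS <= 1)%N by rewrite dim_vline leq_b1.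
  apply: leq_trans le1; apply: dimvS.
  apply/subvP => a; rewrite -[a]complexifyK => /(injective_perp inj u0) [t ->].
  by rewrite realifyZ memvZ // memv_line.
- move=> dimS u u0; apply/eqP; rewrite eqEdim frame_span_sub.
  apply: leq_trans (dimS u u0); rewrite -dimT subn1.
  (* As [i u] is not orthogonal to itself, its complement has codimension exactly one. *)
  suff /eq_dim_orthov1 -> : realify ('i *: u) \notin orthov (@rdot R M) fullv.
    by rewrite capfv.
  apply/mem_orthovPn; exists (realify ('i *: u)); rewrite ?memvf //=.
  by rewrite rdot_eq0 realify_eq0 scaler_eq0 negb_or neq0Ci.
- move=> S x y Axy; have [u0 | u0] := eqVneq (x + y) 0.
    (* The hypothesis on [S] says nothing at [u = 0], but there [y = - x]. *)
    exists (-1); last by rewrite scaleN1r; apply/eqP; rewrite -addr_eq0 addrC u0.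
    by rewrite /= oppr0 expr0n addr0 sqrrN expr1n sqrtr1.
  have /(eq_intensity phi) := Axy; rewrite S // orthovK1 => /vlineP [t].
  rewrite -realifyZ => /(can_inj (@realifyK R M)).
  (* Now [x - y = z (x + y)] with [z = t i], that is, [(1 + z) y = (1 - z) x]. *)
  have [z0 z1] := normc_cayley t; rewrite scalerA; set z := _ * 'i in z0 z1 * => Et.
  exists ((1 - z) / (1 + z)) => //; apply: (scalerI z0).
  rewrite scalerA mulrCA divff // mulr1 scalerBl scalerDl !scale1r.
  by apply/eqP; rewrite eq_sym subr_eq -addrA -scalerDr [y + x]addrC -Et addrC subrK.
Qed.
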